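(* For any composition $\alpha$ (and any $n\geq\ell(\alpha)$), one has $$\overline{M}_\alpha(y_1,\dots,y_n)=\overline{M}_\alpha^{\mathcal{C}}(y_1,\dots,y_n).$$ Furthermore, these polynomials are both quasisymmetric in the variables $y_1,\dots,y_n$.
   Context: A composition is a finite sequence of positive integers; $\ell(\alpha)$ is the number of parts of $\alpha$. For a finite sequence $b$ of nonnegative integers, $b^+$ is obtained by deleting all zeros. Fix a composition $\alpha$ and an integer $n\ge\ell(\alpha)$. Tuples and strings are conflated. $\mathcal{S}_\alpha=\{b\in\mathbb{Z}_{\ge0}^n:b^+=\alpha\}$. $\mathcal{P}_\alpha$ is the closure of $\mathcal{S}_\alpha$ under componentwise maximum (the set of componentwise maxima of nonempty finite collections of elements of $\mathcal{S}_\alpha$), partially ordered componentwise. $\mu_{\mathcal{P}_\alpha}\colon\mathcal{P}_\alpha\to\mathbb{Z}$ is determined by $\sum_{q\le p}\mu_{\mathcal{P}_\alpha}(q)=1$ for all $p\in\mathcal{P}_\alpha$. Consider strings in the alphabet $\{0,1,2,\dots\}\cup\{\bar1,\bar2,\bar3,\dots\}$ (unbarred and barred symbols) and the local moves, for adjacent symbols $0,p$ with $p\in\mathbb{Z}_{>0}$ unbarred: (M.1) $\ldots0p\ldots\Rightarrow\ldots p0\ldots$; (M.2) $\ldots0p\ldots\Rightarrow\ldots p\bar p\ldots$. Let $\widetilde{\mathcal{C}}_\alpha$ be the set of strings obtainable from elements of $\mathcal{S}_\alpha$ by iterated application (zero or more times) of (M.1) and (M.2). Let $\mathcal{C}_\alpha$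 be the set of strings obtained from $\widetilde{\mathcal{C}}_\alpha$ by replacing each barred symbol by the corresponding unbarred symbol, and let $\pi\colon\widetilde{\mathcal{C}}_\alpha\to\mathcal{C}_\alpha$ be this bar-forgetting map. For $\widetilde\sigma\in\widetilde{\mathcal{C}}_\alpha$ let $\mathsf{Bar}(\widetilde\sigma)$ be the number of barred symbols in $\widetilde\sigma$, and for $\sigma\in\mathcal{C}_\alpha$ let $\mu'_{\mathcal{C}_\alpha}(\sigma)=\sum_{\widetilde\sigma\in\pi^{-1}(\sigma)}(-1)^{\mathsf{Bar}(\widetilde\sigma)}$. For a tuple $c$, $\mathbf{y}^c=y_1^{c_1}\cdots y_n^{c_n}$. Define $$\overline{M}_\alpha^{\mathcal{C}}(y_1,\dots,y_n)=\sum_{\sigma\in\mathcal{C}_\alpha}\mu'_{\mathcal{C}_\alpha}(\sigma)\,\mathbf{y}^\sigma,\qquad \overline{M}_\alpha(y_1,\dots,y_n)=\sum_{\sigma\in\mathcal{P}_\alpha}\mu_{\mathcal{P}_\alpha}(\sigma)\,\mathbf{y}^\sigma .$$ A polynomial in $y_1,\dots,y_n$ is quasisymmetric if the coefficients of $\mathbf{y}^b$ and $\mathbf{y}^{c}$ agree whenever $b,c\in\mathbb{Z}_{\ge0}^n$ satisfy $b^+=c^+$. *)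

(* Defs.v *)
From mathcomp Require Import all_boot all_order all_algebra finmap.
From mathcomp Require Import boolp classical_sets functions cardinality fsbigop.
From mathcomp Require Import mpoly.

Set Implicit Arguments.
Unset Strict Implicit.
Unset Printing Implicit Defensive.

Import GRing.Theory.
Local Open Scope classical_set_scope.
Local Open Scope ring_scope.

(* Elements of Z_{>=0}^n are represented by ['X_{1..n}], the type of exponent
   vectors of monomials in n variables.  Beware that [(a <= b)%MM] is the
   componentwise order, whereas [(a <= b)%O] is a total monomial order.
   Sums [\sum_(i \in A) F i] over classical sets are 0 by convention when
   [F] has infinite support on [A]; see [finite_Pset], [finite_Ctilde],
   [finite_Cset] and [finite_mnm_le] below. *)

Definition is_composition (alpha : seq nat) : bool :=
  all (fun a => (0 < a)%N) alpha.

(* b^+ *)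
Definition flat (b : seq nat) : seq nat := [seq x <- b | (0 < x)%N].

Section Posets.
Variable n : nat.
Implicit Types (alpha : seq nat) (b p q : 'X_{1..n}).

Definition Sset alpha : set 'X_{1..n} := [set b | flat b = alpha].

Definition mnm_sup (A : seq 'X_{1..n}) : 'X_{1..n} :=
  [multinom \max_(b <- A) b i | i < n].

Definition Pset alpha : set 'X_{1..n} :=
  [set p | exists A : seq 'X_{1..n},
     [/\ A <> [::], (forall b, b \in A -> Sset alpha b) & p = mnm_sup A]].

Definition mobius_spec (Q : set 'X_{1..n}) (mu : 'X_{1..n} -> int) : Prop :=
  forall p, Q p -> \sum_(q \in [set q | Q q /\ (q <= p)%MM]) mu q = 1.

(* Only the values on [Q] are meaningful; on [Q] they are determined by
   [mobius_spec Q], see [mobiusP] and [mobius_unique]. *)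
Definition mobius (Q : set 'X_{1..n}) : 'X_{1..n} -> int :=
  xget (fun=> 0) [set mu | mobius_spec Q mu].

End Posets.

(* [inl p] is the unbarred symbol p and [inr p] the barred one; [inr 0] is not
   in the alphabet, and it never occurs in a string of [Ctilde]. *)
Notation symbol := (nat + nat)%type.

Definition unbarred (p : nat) : symbol := inl p.
Definition barred (p : nat) : symbol := inr p.
Definition is_barred (x : symbol) : bool := if x is inr _ then true else false.
Definition forget_bar (x : symbol) : nat :=
  match x with inl p => p | inr p => p end.

Inductive move : seq symbol -> seq symbol -> Prop :=
| move1 (u v : seq symbol) (p : nat) of (0 < p)%N :
    move (u ++ [:: unbarred 0; unbarred p] ++ v)
         (u ++ [:: unbarred p; unbarred 0] ++ v)
| move2 (u v : seq symbol) (p : nat) of (0 < p)%N :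
    move (u ++ [:: unbarred 0; unbarred p] ++ v)
         (u ++ [:: unbarred p; barred p] ++ v).

Section Strings.
Variables (n : nat) (alpha : seq nat).

Inductive Ctilde : n.-tuple symbol -> Prop :=
| Ctilde_start (b : 'X_{1..n}) of Sset alpha b :
    Ctilde [tuple unbarred (b i) | i < n]
| Ctilde_move (s t : n.-tuple symbol) of Ctilde s & move s t : Ctilde t.

Definition forget_bars (s : n.-tuple symbol) : 'X_{1..n} :=
  [multinom forget_bar (tnth s i) | i < n].

Definition Cset : set 'X_{1..n} := [set forget_bars s | s in Ctilde].

Definition Bar (s : n.-tuple symbol) : nat := count is_barred s.

Definition mu' (sigma : 'X_{1..n}) : int :=
  \sum_(s \in [set s | Ctilde s /\ forget_bars s = sigma])
    ((-1) ^+ Bar s : int).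

Definition MbarC : {mpoly int[n]} := \sum_(s \in Cset) mu' s *: 'X_[s].

Definition Mbar : {mpoly int[n]} :=
  \sum_(s \in @Pset n alpha) mobius (@Pset n alpha) s *: 'X_[s].

End Strings.

Definition quasisymmetric (n : nat) (f : {mpoly int[n]}) : Prop :=
  forall b c : 'X_{1..n}, flat b = flat c -> f@_b = f@_c.

Section Sanity.
Variables (n : nat) (alpha : seq nat).

Lemma finite_mnm_bounded (m : nat) :
  finite_set [set b : 'X_{1..n} | forall i, (b i <= m)%N].
Proof.
apply: (@sub_finite_set _ _ ((fun t : n.-tuple 'I_m.+1 =>
  [multinom (tnth t i : nat) | i < n]) @` setT)); last first.
  exact: finite_image.
move=> b /= hb; exists [tuple inord (b i) | i < n] => //.
by apply/mnmP => i; rewrite mnmE tnth_mktuple inordK // ltnS.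
Qed.

Lemma finite_mnm_le (Q : set 'X_{1..n}) (p : 'X_{1..n}) :
  finite_set [set q | Q q /\ (q <= p)%MM].
Proof.
apply: sub_finite_set (finite_mnm_bounded (\max_i p i)) => q /= [_] /mnm_lepP h i.
exact: leq_trans (h i) (leq_bigmax i).
Qed.

Lemma Sset_bounded (b : 'X_{1..n}) : Sset alpha b ->
  forall i, (b i <= \max_(a <- alpha) a)%N.
Proof.
move=> hb i; have [-> //|] := posnP (b i) => bi.
suff : b i \in alpha by move=> h; rewrite (leq_bigmax_seq _ h).
by rewrite -hb /flat mem_filter bi /= mem_tnth.
Qed.

Lemma finite_Pset : finite_set (@Pset n alpha).
Proof.
apply: sub_finite_set (finite_mnm_bounded (\max_(a <- alpha) a)).
move=> p [A [_ hA ->]] i; rewrite mnmE.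
by apply/bigmax_leqP_seq => b bA _; apply: Sset_bounded; exact: hA.
Qed.

Lemma Ctilde_bounded (s : n.-tuple symbol) : Ctilde alpha s ->
  all (fun x => (forget_bar x <= \max_(a <- alpha) a)%N) s.
Proof.
elim=> {s} [b hb|s t _ IH st].
  by apply/all_tnthP => i; rewrite tnth_mktuple /=; exact: Sset_bounded.
by case: st IH => u v p _; rewrite !all_cat /= !andbT => /and3P[-> hp ->];
  rewrite hp.
Qed.

Lemma finite_Ctilde : finite_set [set s : n.-tuple symbol | Ctilde alpha s].
Proof.
set m := (\max_(a <- alpha) a)%N.
pose f (x : 'I_m.+1 + 'I_m.+1) : symbol :=
  match x with inl p => unbarred p | inr p => barred p end.
apply: (@sub_finite_set _ _
  ((fun t : n.-tuple ('I_m.+1 + 'I_m.+1)%type => map_tuple f t) @` setT));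
  last exact: finite_image.
move=> s /= /Ctilde_bounded /all_tnthP hs.
exists [tuple match tnth s i with
  | inl p => inl (inord p) | inr p => inr (inord p) end | i < n] => //.
apply/eq_from_tnth => i; rewrite tnth_map tnth_mktuple.
by move: (hs i); case: (tnth s i) => p /= hp; rewrite inordK // ltnS.
Qed.

Lemma finite_Cset : finite_set (@Cset n alpha).
Proof. exact: finite_image finite_Ctilde. Qed.

Lemma Ctilde_symbols (s : n.-tuple symbol) : Ctilde alpha s -> barred 0 \notin tval s.
Proof.
elim=> {s} [b _|s t _ IH st].
  by apply/negP => /tnthP[i]; rewrite tnth_mktuple.
case: st IH => u v p p0; rewrite !mem_cat !inE !negb_or.
  by move=> /and3P[-> _ ->].
move=> /and3P[-> _ ->] /=; rewrite andbT.
by apply/eqP => -[p0']; rewrite -p0' in p0.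
Qed.

End Sanity.

Section MobiusExists.
Variables (n : nat) (Q : set 'X_{1..n}).

Fixpoint mobius_rec (k : nat) (p : 'X_{1..n}) : int :=
  if k is k'.+1 then
    1 - \sum_(q \in [set q | Q q /\ (q <= p)%MM] `\ p) mobius_rec k' q
  else 0.

Lemma ltm_mdeg (p q : 'X_{1..n}) :
  (q <= p)%MM -> q <> p -> (mdeg q < mdeg p)%N.
Proof.
move=> /mnm_lepP le ne; rewrite ltnNge; apply/negP => h; apply: ne.
have e : (p = q + (p - q))%MM by apply/mnmP => i; rewrite mnmDE mnmBE subnKC.
move: h; rewrite [in mdeg p]e mdegD -[leqRHS]addn0 leq_add2l leqn0 mdeg_eq0.
by move=> /eqP e0; rewrite [RHS]e e0 addm0.
Qed.

Lemma mobius_rec_stable (k l : nat) (p : 'X_{1..n}) :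
  (mdeg p < k)%N -> (mdeg p < l)%N -> mobius_rec k p = mobius_rec l p.
Proof.
elim: k l p => // k IH [//|l] p pk pl /=; congr (_ - _).
apply: eq_fsbigr => q; rewrite inE => -[[_ qp] ne].
have lt := ltm_mdeg qp ne.
by apply: IH; apply: leq_trans lt _; rewrite -ltnS.
Qed.

Lemma mobius_exists : mobius_spec Q (fun p => mobius_rec (mdeg p).+1 p).
Proof.
move=> p Qp; rewrite (fsbigD1 p _ _ (finite_mnm_le Q p)) /=; last first.
  by split => //; exact: lepm_refl.
rewrite -addrA -[RHS]addr0; congr (_ + _); rewrite addrC.
apply/eqP; rewrite subr_eq0; apply/eqP.
apply: eq_fsbigr => q; rewrite inE => -[[_ qp] ne].
by apply: (@mobius_rec_stable (mdeg q).+1 (mdeg p)) => //; exact: ltm_mdeg.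
Qed.

Lemma mobiusP : mobius_spec Q (mobius Q).
Proof. by rewrite /mobius; case: xgetP => // /(_ _ mobius_exists). Qed.

Lemma mobius_unique (mu nu : 'X_{1..n} -> int) :
  mobius_spec Q mu -> mobius_spec Q nu -> forall p, Q p -> mu p = nu p.
Proof.
move=> hmu hnu p; have [k] := ubnP (mdeg p).
elim: k p => // k IH p pk Qp.
have inp : Q p /\ (p <= p)%MM by split => //; exact: lepm_refl.
have := hmu p Qp; rewrite (fsbigD1 p _ _ (finite_mnm_le Q p) inp).
have := hnu p Qp; rewrite (fsbigD1 p _ _ (finite_mnm_le Q p) inp) => <-.
rewrite (eq_fsbigr nu); first by move/addIr.
move=> q; rewrite inE => -[[Qq qp] ne]; apply: IH => //.
by apply: leq_trans (ltm_mdeg qp ne) _; rewrite -ltnS.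
Qed.

End MobiusExists.

(* Main.v *)
(* The strings of [Ctilde] are exactly those of the form
   0* a_1 {0, bar a_1}* a_2 {0, bar a_2}* ... a_l {0, bar a_l}*.
   Zeros can thus be inserted and deleted freely, so mu' of a vector depends only on its
   nonzero entries, which is quasisymmetry.  Summing (-1)^Bar over the strings below a fixed
   p, a position in the block of a_j whose entry of p is at least a_j contributes 0 and
   bar a_j with opposite signs.  Only strings without such positions survive: there, a_l is
   at the last position where p is at least a_l, a_(l-1) at the last position before it
   where p is at least a_(l-1), and so on.  Hence exactly one string survives as soon as p
   dominates an element of S_alpha, so mu' satisfies the recursion defining the Moebius
   function of P_alpha. *)

Require Import Defs.
From mathcomp Require Import all_boot all_order all_algebra.
From mathcomp Require Import mpoly.
From mathcomp Require Import finmap boolp classical_sets functions cardinality.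
From mathcomp Require Import fsbigop ring.
From Stdlib Require Import Relation_Operators.

Set Implicit Arguments.
Unset Strict Implicit.
Unset Printing Implicit Defensive.

Import GRing.Theory.
Local Open Scope classical_set_scope.
Local Open Scope ring_scope.

(** * The grammar of the strings in [Ctilde] *)

(* [w] continues a string of [Ctilde] whose last unbarred letter is [c] ([0] if there is none yet),
   [r] being the unbarred letters still to come. *)
Fixpoint valid (c : nat) (r : seq nat) (w : seq symbol) : bool :=
  match w with
  | [::] => r == [::]
  | inl 0 :: w' => valid c r w'
  | inl p :: w' => if r is a :: r' then (a == p) && valid a r' w' else false
  | inr p :: w' => [&& 0 < p, p == c & valid c r w']%N
  end.

Lemma flat_cons x s : flat (x :: s) = if (0 < x)%N then x :: flat s else flat s.
Proof. by []. Qed.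

Lemma valid_unbarred c s : valid c (flat s) (map unbarred s).
Proof.
by elim: s c => //= -[|x] s IH c /=; rewrite ?eqxx; exact: IH.
Qed.

(** The moved letter becomes the current one a position earlier, so a zero or its barred copy may
    follow it, and [v] is read in the same state as before. *)
Lemma valid_move c r s t : move s t -> valid c r s -> valid c r t.
Proof.
have valid_prefix u x y : (forall c r, valid c r x -> valid c r y) ->
    forall c r, valid c r (u ++ x) -> valid c r (u ++ y).
  move=> xy; elim: u => //= -[[|p]|p] u IH c' r' //.
  - exact: IH.
  - by case: r' => // a r' /andP[-> /IH].
  - by move=> /and3P[-> -> /IH].
case=> u v p p0; apply: valid_prefix => c' r';
  case: p p0 => // p _ /=; case: r' => // a r' /andP[/eqP-> h] /=;
  by rewrite ?eqxx.
Qed.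

Definition moves := clos_refl_trans_n1 _ move.

Lemma moves_cons x s t : moves s t -> moves (x :: s) (x :: t).
Proof.
elim=> [|{}t u mv _ IH]; first exact: rtn1_refl.
apply: rtn1_trans IH.
case: mv => u' v' p p0; rewrite -!cat_cons.
- exact: move1.
- exact: move2.
Qed.

Lemma moves_step s t u : moves s t -> move t u -> moves s u.
Proof. by move=> st tu; apply: rtn1_trans st. Qed.

(** [Ctilde] for lists of any length, so that inductions can strip the first symbol. *)
Definition reachable (r : seq nat) (w : seq symbol) : Prop :=
  exists b, [/\ flat b = r, size b = size w & moves (map unbarred b) w].

Lemma reachable0 r w : reachable r w -> reachable r (unbarred 0 :: w).
Proof.
by case=> b [<- sb mv]; exists (0%N :: b); split=> //=; [rewrite sb | exact: moves_cons].
Qed.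

Lemma reachable_cons c r w : (0 < c)%N -> reachable r w ->
  reachable (c :: r) (unbarred c :: w).
Proof.
move=> c0 [b [<- sb mv]]; exists (c :: b); split=> //=.
- by rewrite c0.
- by rewrite sb.
- exact: moves_cons.
Qed.

Lemma reachable_move r s t : reachable r s -> move s t -> reachable r t.
Proof.
case=> b [fb sb mv] st; exists b; split=> //; last exact: moves_step st.
by rewrite sb; case: st => u v p _; rewrite !size_cat.
Qed.

(** Built from the right: once [c] followed by the tail is reachable, a zero placed in front turns
    by [move1] or [move2] into [c] followed by a zero or by [barred c]. *)
Lemma valid_reachable_cons c r w : (0 < c)%N -> is_composition r ->
  valid c r w -> reachable (c :: r) (unbarred c :: w).
Proof.
elim: w c r => [|[[|p]|p] w IH] c r c0 rc /=.
- move=> /eqP->; apply: reachable_cons => //.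
  by exists [::]; split=> //; exact: rtn1_refl.
- move=> /(IH _ _ c0 rc) /reachable0 /reachable_move; apply.
  exact: (@move1 [::] w c).
- case: r rc => // a r /andP[a0 rc] /andP[/eqP-> /(IH p.+1 r isT rc) h].
  exact: reachable_cons.
- move=> /and3P[_ /eqP-> /(IH _ _ c0 rc)] /reachable0 /reachable_move; apply.
  exact: (@move2 [::] w c).
Qed.

Lemma valid_reachable r w : is_composition r -> valid 0 r w -> reachable r w.
Proof.
move=> rc; elim: w => [|[[|p]|p] w IH] /=.
- by move=> /eqP->; exists [::]; split=> //; exact: rtn1_refl.
- by move=> /IH /reachable0.
- case: r rc {IH} => // a r /andP[a0 rc] /andP[/eqP-> h].
  exact: valid_reachable_cons.
- by case: p.
Qed.

Lemma CtildeP n alpha (s : n.-tuple symbol) : is_composition alpha ->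
  Ctilde alpha s <-> valid 0 alpha s.
Proof.
move=> ac; split.
  elim=> {s} [b <-|s t _ IH st]; last exact: valid_move st IH.
  rewrite (_ : tval _ = map unbarred b) ?valid_unbarred //.
  by rewrite -[in RHS](map_tnth_enum b) -map_comp.
case: s => w sw /= /(valid_reachable ac)[b [fb sb mv]].
elim: mv sw sb => [|{}w u wu mv IH] sw sb.
  have sbn : size b == n by rewrite -(eqP sw) size_map.
  rewrite (_ : Tuple sw = [tuple unbarred ([multinom Tuple sbn] i) | i < n]).
    exact: Ctilde_start.
  apply: eq_from_tnth => i; rewrite tnth_mktuple /fun_of_multinom /=.
  by rewrite (tnth_nth (unbarred 0)) (tnth_nth 0%N) /= (nth_map 0%N) // (eqP sbn).
(* Moves preserve length, so the intermediate lists are again [n]-tuples. *)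
have sz : size w = size u by case: wu => *; rewrite !size_cat.
have sw' : size w == n by rewrite sz.
by apply: (@Ctilde_move _ _ (Tuple sw')) => //; apply: IH; rewrite sz.
Qed.

(** * Enumeration of strings under positionwise constraints *)

(** [Ps] constrains each entry after bars are forgotten: equality tests give a fibre of
    [forget_bars], upper bounds give the strings below a vector. *)
Fixpoint words (c : nat) (r : seq nat) (Ps : seq (pred nat)) : seq (seq symbol) :=
  if Ps is P :: Ps' then
    (if P 0 then map (cons (unbarred 0)) (words c r Ps') else [::]) ++
    (if r is a :: r' then
       if P a then map (cons (unbarred a)) (words a r' Ps') else [::]
     else [::]) ++
    (if (0 < c)%N && P c then map (cons (barred c)) (words c r Ps') else [::])
  else if r is [::] then [:: [::]] else [::].

Definition admits (Ps : seq (pred nat)) (w : seq symbol) : bool :=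
  all2 (fun (P : pred nat) x => P (forget_bar x)) Ps w.

Lemma mem_map_cons (T : eqType) (x y : T) s L :
  (x :: s \in map (cons y) L) = (x == y) && (s \in L).
Proof.
apply/mapP/andP => [[t tL [-> ->]]|[/eqP-> sL]]; first by rewrite eqxx.
by exists s.
Qed.

Lemma nil_map_cons (T : eqType) (y : T) L : ([::] \in map (cons y) L) = false.
Proof. by apply/mapP => -[]. Qed.

Lemma mem_words c r Ps w : is_composition r ->
  (w \in words c r Ps) = valid c r w && admits Ps w.
Proof.
elim: Ps c r w => [|P Ps IH] c r w rc.
  case: w => [|x w] /=; first by case: r rc.
  by rewrite andbF; case: r rc.
rewrite /= !mem_cat; case: w => [|x w].
  rewrite andbF; case: r rc => [|a r] rc; repeat case: ifP => // _;
  by rewrite ?nil_map_cons.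
have ifcons y (b : bool) L : (x :: w \in if b then map (cons y) L else [::]) =
    [&& b, x == y & w \in L] by case: b => //; rewrite mem_map_cons.
have -> : (x :: w \in if r is a :: r' then
       if P a then map (cons (unbarred a)) (words a r' Ps) else [::]
     else [::]) = (if r is a :: r' then
       [&& P a, x == unbarred a & w \in words a r' Ps] else false).
  by case: r rc => // a r _; exact: ifcons.
rewrite !ifcons IH //= -/(admits _ _).
case: x {ifcons} => -[|p] /=.
- rewrite !andbF orbF; case: r rc => [|a r] /=; last first.
    by case/andP; case: a => // a _ _; rewrite !andbF !orbF; case: (P 0); rewrite ?andbF.
  by rewrite orbF; case: (P 0); rewrite ?andbF.
- rewrite !andbF orbF /=; case: r rc => [|a r] //= /andP[_ rc].
  rewrite IH // (inj_eq (can_inj (fun _ => erefl : forget_bar (inl _) = _))).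
  rewrite [p.+1 == a]eq_sym; case: eqP => [->|_] /=; last by rewrite andbF.
  by case: (P p.+1); rewrite ?andbF.
- rewrite !andbF /=; case: r rc => [|a r] _; rewrite ?andbF /=;
  by case: c => [|c]; rewrite ?andbF.
- have -> : (inr p.+1 == barred c :> symbol) = (p.+1 == c) by [].
  have -> : (if r is a :: r' then
     [&& P a, inr p.+1 == unbarred a & w \in words a r' Ps] else false) = false.
    by case: r rc => // a r _; rewrite andbF.
  rewrite !andbF /=; case: eqP => [<-|_] /=; last by rewrite andbF.
  by case: (P p.+1); rewrite ?andbF.
Qed.

Lemma words_uniq c r Ps : is_composition r -> uniq (words c r Ps).
Proof.
elim: Ps c r => [|P Ps IH] c r rc /=; first by case: r rc.
have consI (x : symbol) : injective (cons x) by move=> ? ? [].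
have disj (x y : symbol) L L' : x != y ->
    has (mem (map (cons x) L)) (map (cons y) L') = false.
  move=> xy; apply/hasP => -[_ /mapP[s _ ->]] /=.
  by rewrite mem_map_cons eq_sym (negbTE xy).
have has_nil (L : seq (seq symbol)) : has (mem [::]) L = false by elim: L.
rewrite !cat_uniq has_cat !negb_or.
case: r rc => [|a r] /=; last move=> /andP[a0 rc].
  by move=> _; case: ifP => _; case: ifP => _;
    rewrite /= ?map_inj_uniq ?IH ?disj ?has_nil.
have rc' : is_composition (a :: r) by rewrite /= a0.
have a0' : unbarred a != unbarred 0 by case: a a0 {rc'}.
by case: ifP => _; case: ifP => _; case: ifP => _;
  rewrite /= ?map_inj_uniq ?IH ?disj ?has_nil // eq_sym.
Qed.

(** * Signed counts of strings *)

Definition weight (c : nat) (r : seq nat) (Ps : seq (pred nat)) : int :=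
  \sum_(w <- words c r Ps) (-1) ^+ count is_barred w.

Lemma weight_cons c r P Ps : weight c r (P :: Ps) =
  (if P 0%N then weight c r Ps else 0) +
  (if r is a :: r' then if P a then weight a r' Ps else 0 else 0) -
  (if (0 < c)%N && P c then weight c r Ps else 0).
Proof.
rewrite /weight /= !big_cat /= -addrA; congr (_ + (_ + _)).
- by case: ifP => _; rewrite ?big_nil // big_map.
- by case: r => [|a r]; [|case: ifP => _]; rewrite ?big_nil // big_map.
- case: ifP => _; rewrite ?big_nil ?oppr0 // big_map -sumrN.
  by apply: eq_bigr => w _; rewrite /= exprS mulN1r.
Qed.

(** Where the entry must be zero, positivity of the letters leaves only [unbarred 0], which changes
    neither [c] nor [r]. *)
Lemma weight_flat c r s : is_composition r ->
  weight c r [seq (eq_op^~ x : pred nat) | x <- s] = weight c r [seq (eq_op^~ x : pred nat) | x <- flat s].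
Proof.
elim: s c r => [//|x s IH] c r rc; rewrite flat_cons; case: posnP => [->|x0] /=.
  rewrite weight_cons /= IH //; case: c => [|c] /=; rewrite subr0;
  by case: r rc => [|[|a] r] //= _; rewrite addr0.
by rewrite !weight_cons !IH //; case: r rc => // a r /andP[_ rc]; rewrite !IH.
Qed.

(* Greedy test for the existence of a sequence below [s] whose nonzero entries spell [r]. *)
Fixpoint embeds (r s : seq nat) : bool :=
  match r, s with
  | [::], _ => true
  | _, [::] => false
  | a :: r', x :: s' => if (a <= x)%N then embeds r' s' else embeds r s'
  end.

(** Proved together: when greedy matching spends an entry on the first letter, each half needs the
    other for a shorter [s]. *)
Lemma embeds_cons r s : (forall x, embeds r s -> embeds r (x :: s)) /\
  (forall a, embeds (a :: r) s -> embeds r s).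
Proof.
elim: s r => [|y s IH] r; first by case: r.
split=> [x|a h]; last first.
  by apply: (IH r).1; move: h => /=; case: ifP => // _; exact: (IH r).2.
case: r => // b r h.
have -> : embeds (b :: r) [:: x, y & s] =
  if (b <= x)%N then embeds r (y :: s) else embeds (b :: r) (y :: s) by [].
case: ifP => // _; apply: (IH r).1; move: h => /=.
by case: ifP => // _; exact: (IH r).2.
Qed.

(** Where [b] has a zero, the greedy test may already use the entry of [s]; by [embeds_cons] this
    does no harm. *)
Lemma embeds_flat b s : all2 leq b s -> embeds (flat b) s.
Proof.
elim: b s => [|x b IH] [|y s] // /= /andP[xy /IH h].
rewrite -/(embeds _ (y :: s)) -/(flat b).
case: (posnP x) => [_|x0]; first exact: (embeds_cons _ _).1.
by rewrite /= xy.
Qed.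

(* The subtracted term removes the embeddings in which the current letter [c] could be moved
   further right. *)
Lemma weight_leq c r p : is_composition r ->
  weight c r [seq (leq^~ x : pred nat) | x <- p] =
  (embeds r p)%:R - ((0 < c)%N && embeds (c :: r) p)%:R.
Proof.
elim: p c r => [|x p IH] c r rc /=.
  by rewrite /weight andbF subr0; case: r rc => [|a r] _; rewrite /= ?big_nil // big_seq1.
rewrite weight_cons leq0n IH //.
case: r rc => [|a r] rc /=.
  have -> : embeds [::] p by case: (p).
  by case: (posnP c) => c0 /=; [|case: (leqP c x) => _]; rewrite /=; ring.
case/andP: (rc) => a0 rc'; rewrite IH // a0 /=.
(* If [0 < c <= x], the choices [0] and [barred c] cancel and only placing [a] can contribute.
   Otherwise, if [a <= x], the subtracted term from placing [a] cancels the term [embeds (a :: r) p]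
   from the choice [0]. *)
by case: (posnP c) => c0; case: (leqP a x) => ax; case: (leqP c x) => cx /=; ring.
Qed.

(** * From sums over [Ctilde] to weights *)

Lemma fsum_tval n (A : set (n.-tuple symbol)) (L : seq (seq symbol))
    (F : seq symbol -> int) :
  uniq L -> (forall w, w \in L <-> exists2 t, A t & tval t = w) ->
  \sum_(t \in A) F t = \sum_(w <- L) F w.
Proof.
move=> uL AL; rewrite (fsbig_seq _ _ uL).
have -> : [set` L] = [set tval t | t in A].
  apply/seteqP; split=> w /=; first by move=> /AL.
  by move=> Aw; apply/AL.
by rewrite fsbig_image // => s t _ _; exact: val_inj.
Qed.

Lemma fsum_Ctilde n alpha (D : set 'X_{1..n}) (Ps : seq (pred nat)) :
  is_composition alpha ->
  (forall s : n.-tuple symbol, D (forget_bars s) <-> admits Ps s) ->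
  size Ps = n ->
  \sum_(s \in [set s : n.-tuple symbol | Ctilde alpha s /\ D (forget_bars s)])
     ((-1) ^+ Bar s : int) = weight 0 alpha Ps.
Proof.
move=> ac DP szP.
apply: (@fsum_tval _ _ _ (fun w => (-1) ^+ count is_barred w)); first exact: words_uniq.
move=> w; rewrite mem_words //; split.
  case/andP=> vw aw; have sw : size w == n.
    by rewrite -szP; move: aw; rewrite /admits all2E => /andP[/eqP->].
  by exists (Tuple sw) => //=; split; [apply/(CtildeP _ ac)|apply/DP].
by case=> s [/(CtildeP _ ac) vs /DP aws] <-; rewrite vs.
Qed.

Lemma tval_forget_bars n (s : n.-tuple symbol) :
  forget_bars s = map forget_bar s :> seq nat.
Proof.
rewrite -[in RHS](map_tnth_enum s) -map_comp.
by rewrite -[in LHS](map_tnth_enum (forget_bars s)); apply: eq_map => i /=; rewrite tnth_mktuple.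
Qed.

Lemma admits_map (R : rel nat) (q : seq nat) (s : seq symbol) :
  admits [seq (R^~ x : pred nat) | x <- q] s = all2 R (map forget_bar s) q.
Proof. by elim: q s => [|x q IH] [|y s] //=; rewrite IH. Qed.

Lemma mu'E n alpha (q : 'X_{1..n}) : is_composition alpha ->
  mu' alpha q = weight 0 alpha [seq (eq_op^~ x : pred nat) | x <- q].
Proof.
move=> ac; apply: (@fsum_Ctilde _ _ [set q]) => //; last by rewrite size_map size_tuple.
move=> s /=; rewrite admits_map -eqseq_all -tval_forget_bars.
by split=> [->//|/eqP e]; do 2 apply: val_inj.
Qed.

Lemma all2_mnm_le n (p q : 'X_{1..n}) : all2 leq q p = (q <= p)%MM.
Proof.
rewrite all2E !size_tuple eqxx /=; apply/(all_nthP (0, 0)%N)/mnm_lepP => [h i|h i].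
  have := h i; rewrite size_zip !size_tuple minnn nth_zip ?size_tuple //=.
  by rewrite -!mnm_nth; apply.
rewrite size_zip !size_tuple minnn => ltin; rewrite nth_zip ?size_tuple //=.
by have := h (Ordinal ltin); rewrite !(mnm_nth 0%N).
Qed.

Lemma fsum_fibers (I J : choiceType) (h : I -> J) (A : set I) (D : set J)
    (F : I -> int) :
  finite_set A -> finite_set D -> (forall i, A i -> D (h i)) ->
  \sum_(j \in D) \sum_(i \in [set i | A i /\ h i = j]) F i = \sum_(i \in A) F i.
Proof.
move=> fA fD AD.
transitivity (\sum_(j \in D) \sum_(i \in A) if h i == j then F i else 0).
  apply: eq_fsbigr => j _.
  rewrite (_ : [set i | _] = A `&` [set i | h i = j]) // fsbig_mkcondr.
  apply: eq_fsbigr => i _; congr (if _ then _ else _).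
  by apply/idP/eqP; rewrite inE.
rewrite exchange_fsbig //; apply: eq_fsbigr => i; rewrite inE => Ai.
rewrite (fsbigD1 (h i)) ?eqxx //; last exact: AD.
by rewrite fsbig1 /= ?addr0 // => j [_ /= ne]; case: eqP => // /esym.
Qed.

(** * Inclusion of [Cset] in [Pset] *)

(** The witness keeps the unbarred letters and replaces the barred ones by zeros. *)
Lemma valid_below_le c r w : is_composition r -> valid c r w ->
  exists b, flat b = r /\ all2 leq b (map forget_bar w).
Proof.
elim: w c r => [|[[|p]|p] w IH] c r rc /=.
- by move=> /eqP->; exists [::].
- by move=> /(IH _ _ rc)[b [fb bw]]; exists (0%N :: b).
- case: r rc => // a r /= /andP[_ rc] /andP[/eqP-> /(IH _ _ rc)[b [<- bw]]].
  by exists (p.+1 :: b); rewrite /= leqnn.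
- by move=> /and3P[_ _ /(IH _ _ rc)[b [fb bw]]]; exists (0%N :: b).
Qed.

(* The second alternative is for a barred [c]: it is matched by moving the preceding letter [c],
   which is not counted in [r], to position [i]. *)
Lemma valid_below_at c r w i : is_composition r -> valid c r w ->
  (i < size w)%N ->
  exists b, [/\ flat b = r \/ (0 < c)%N /\ flat b = c :: r,
    all2 leq b (map forget_bar w) &
    nth 0%N b i = nth 0%N (map forget_bar w) i].
Proof.
elim: w c r i => [|x w IH] c r i rc //=; case: x => -[|p] //.
- move=> vw; case: i => [_|i iw].
    have [b [fb bw]] := valid_below_le rc vw.
    by exists (0%N :: b); split=> //; left.
  have [b [fb bw bi]] := IH _ _ _ rc vw iw.
  by exists (0%N :: b).
- case: r rc => // a r /= /andP[_ rc] /andP[/eqP-> vw]; case: i => [_|i iw].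
    have [b [<- bw]] := valid_below_le rc vw.
    by exists (p.+1 :: b); split; rewrite /= ?leqnn //; left.
  have [b [[fb|[_ fb]] bw bi]] := IH _ _ _ rc vw iw.
    by exists (p.+1 :: b); rewrite /= leqnn -/(flat b) fb; split=> //; left.
  (* The tail already contains the letter [p.+1], moved right to position [i], so its old place gets
     a zero. *)
  by exists (0%N :: b); rewrite /= -/(flat b) fb; split=> //; left.
- move=> /and3P[_ /eqP<- vw]; case: i => [_|i iw].
    have [b [<- bw]] := valid_below_le rc vw.
    by exists (p.+1 :: b); split; rewrite /= ?leqnn //; right.
  have [b [fb bw bi]] := IH _ _ _ rc vw iw.
  by exists (0%N :: b).
Qed.

Lemma all2_leq_mnm n (p : 'X_{1..n}) (b : seq nat) : all2 leq b p ->
  exists2 q : 'X_{1..n}, (q <= p)%MM & b = q.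
Proof.
move=> bp; have sb : size b == n.
  by move: bp; rewrite all2E size_tuple => /andP[].
by exists (Multinom (Tuple sb)) => //; rewrite -all2_mnm_le.
Qed.

(** The vector is the maximum of all elements of [Sset alpha] below it, since [valid_below_at]
    attains each of its entries. *)
Lemma Cset_sub_Pset n alpha : is_composition alpha ->
  @Cset n alpha `<=` @Pset n alpha.
Proof.
move=> ac _ [s /(CtildeP _ ac) vs <-]; set p := forget_bars s.
have below b : flat b = alpha -> all2 leq b (map forget_bar s) ->
    exists2 q : 'X_{1..n}, Sset alpha q /\ (q <= p)%MM & b = q.
  by rewrite -tval_forget_bars => fb /all2_leq_mnm[q qp bq]; exists q; rewrite // /Sset /= -bq.
have [A memA] : exists A : seq 'X_{1..n}, forall q,
    (q \in A) = `[< Sset alpha q /\ (q <= p)%MM >].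
  exists (fset_set [set q | Sset alpha q /\ (q <= p)%MM]) => q.
  by rewrite in_fset_set //; exact: finite_mnm_le.
exists A; split.
- have [b [fb bs]] := valid_below_le ac vs; have [q qA _] := below b fb bs.
  by move=> A0; have := memA q; rewrite asboolT // A0.
- by move=> b; rewrite memA => /asboolP[].
- apply/mnmP => i; rewrite [RHS]mnmE; apply/eqP; rewrite eqn_leq; apply/andP; split.
    have si : (i < size s)%N by rewrite size_tuple.
    have [b [[fb|[]//] bs bi]] := valid_below_at ac vs si.
    have [q qA bq] := below b fb bs.
    have <- : q i = p i by rewrite !(mnm_nth 0%N) -bq bi tval_forget_bars.
    by apply: leq_bigmax_seq => //; rewrite memA; exact/asboolP.
  by apply/bigmax_leqP_seq => q; rewrite memA => /asboolP[_ /mnm_lepP].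
Qed.

(** * The Moebius recursion for [mu'] *)

Lemma Pset_embeds n alpha (p : 'X_{1..n}) : Pset alpha p -> embeds alpha p.
Proof.
case=> [[|b A] [nonnil AS ->]] //.
have <- : flat b = alpha by apply: AS; rewrite mem_head.
apply: embeds_flat; rewrite all2_mnm_le; apply/mnm_lepP => i.
by rewrite mnmE big_cons leq_maxl.
Qed.

Lemma mu'_notin n alpha (q : 'X_{1..n}) : ~ Cset alpha q -> mu' alpha q = 0.
Proof.
move=> qC; rewrite /mu' (_ : [set s | _] = set0) ?fsbig_set0 //.
by apply/seteqP; split=> // s [Cs sq]; apply: qC; exists s.
Qed.

Lemma mobius_spec_mu' n alpha : is_composition alpha ->
  mobius_spec (@Pset n alpha) (mu' alpha).
Proof.
move=> ac p Pp.
pose A := [set s : n.-tuple symbol | Ctilde alpha s /\ (forget_bars s <= p)%MM].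
transitivity (\sum_(s \in A) ((-1) ^+ Bar s : int)); last first.
  rewrite (@fsum_Ctilde _ _ [set q | (q <= p)%MM] [seq (leq^~ x : pred nat) | x <- p]) //.
  (* The starting letter is [0], so the subtracted term of [weight_leq] vanishes. *)
  - by rewrite weight_leq // (Pset_embeds Pp) subr0.
  - by move=> s; rewrite admits_map -tval_forget_bars all2_mnm_le.
  - by rewrite size_map size_tuple.
(* Group the strings below [p] by image; [Cset_sub_Pset] ensures that every image is among the
   indices. *)
rewrite -(@fsum_fibers _ _ (@forget_bars n) A [set q | Pset alpha q /\ (q <= p)%MM]).
- apply: eq_fsbigr => q; rewrite inE => -[_ qp]; apply: eq_fsbigl.
  by apply/seteqP; split=> s [Cs sq]; [rewrite /A /= sq | case: Cs].
- by apply: sub_finite_set (finite_Ctilde n alpha) => s [].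
- exact: finite_mnm_le.
- by move=> s [Cs sp]; split=> //; apply: Cset_sub_Pset => //; exists s.
Qed.

(** As [mu'] vanishes off [Cset], both sums can be taken over [Pset], where the Moebius function is
    unique. *)
Lemma MbarE n alpha : is_composition alpha -> Mbar n alpha = MbarC n alpha.
Proof.
move=> ac; rewrite /Mbar /MbarC.
rewrite [RHS](fsbig_widen _ _ _ (Cset_sub_Pset ac)).
  apply: eq_fsbigr => q; rewrite inE => Pq; congr (_ *: _).
  by apply: mobius_unique Pq; [exact: mobiusP | exact: mobius_spec_mu'].
by move=> q [_ /mu'_notin /= ->]; rewrite scale0r.
Qed.

(** * Coefficients and quasisymmetry *)

Lemma mcoeff_MbarC n alpha (b : 'X_{1..n}) : (MbarC n alpha)@_b = mu' alpha b.
Proof.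
rewrite /MbarC fsbig_finite; last exact: finite_Cset.
rewrite raddf_sum /=.
under eq_bigr do rewrite mcoeffZ mcoeffX.
have [Cb|nCb] := pselect (Cset alpha b); last first.
  rewrite mu'_notin // big_seq big1 // => q.
  rewrite in_fset_set; last exact: finite_Cset.
  by rewrite inE => Cq; case: eqP => [qb|_]; [rewrite qb in Cq | rewrite mulr0].
rewrite (bigD1_seq b) ?fset_uniq //=; last first.
  by rewrite in_fset_set ?inE //; exact: finite_Cset.
rewrite eqxx mulr1 big1 ?addr0 // => q /negbTE->.
by rewrite mulr0.
Qed.

Lemma quasisymmetric_MbarC n alpha : is_composition alpha ->
  quasisymmetric (MbarC n alpha).
Proof.
move=> ac b c bc; rewrite !mcoeff_MbarC !mu'E //.
by rewrite weight_flat // bc -weight_flat.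
Qed.

Theorem theorem3p9 (n : nat) (alpha : seq nat)
    (alpha_comp : is_composition alpha) (le_alpha_n : (size alpha <= n)%N) :
  Mbar n alpha = MbarC n alpha /\
  quasisymmetric (Mbar n alpha) /\ quasisymmetric (MbarC n alpha).
Proof.
rewrite MbarE //; split=> //.
by split; exact: quasisymmetric_MbarC.
Qed.
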